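(* Let $X$ be a set with $|X|\ge 3$. For every integer $n\ge 3$, we have $\mathcal{F}^n_1=\mathcal{F}^n_{n-2}$.
   Context: An operation $F\colon X^n\to X$ is associative if $F(x_1,\ldots,x_{i-1},F(x_i,\ldots,x_{i+n-1}),x_{i+n},\ldots,x_{2n-1})=F(x_1,\ldots,x_i,F(x_{i+1},\ldots,x_{i+n}),x_{i+n+1},\ldots,x_{2n-1})$ for all $x_1,\ldots,x_{2n-1}\in X$ and $1\le i\le n-1$. For $k\in\{1,\ldots,n\}$, $\mathcal{F}^n_k$ is the class of associative operations $F\colon X^n\to X$ such that $F(x_1,\ldots,x_n)\in\{x_1,\ldots,x_n\}$ whenever at least $k$ of the components $x_1,\ldots,x_n$ are equal to each other. *)

(* Defs.v *)
From mathcomp Require Import all_boot.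
From mathcomp Require Import zify.
From mathcomp Require Import boolp classical_sets functions cardinality.

Set Implicit Arguments.
Unset Strict Implicit.
Unset Printing Implicit Defensive.

Local Open Scope classical_set_scope.

Section NaryOperations.
Variables (X : Type) (n : nat).
Implicit Types (F : n.-tuple X -> X) (x : (2 * n).-1.-tuple X) (i j : 'I_n).

(* Indices are 0-based: positions 0, ..., 2n-2 carry x_1, ..., x_{2n-1}. *)

Lemma block_index_subproof i j : i + j < (2 * n).-1.
Proof. have := ltn_ord i; have := ltn_ord j; lia. Qed.

Lemma head_index_subproof j : j < (2 * n).-1.
Proof. have := ltn_ord j; lia. Qed.

Lemma tail_index_subproof j : j + n.-1 < (2 * n).-1.
Proof. have := ltn_ord j; lia. Qed.

Definition block_index i j : 'I_(2 * n).-1 := Ordinal (block_index_subproof i j).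
Definition head_index j : 'I_(2 * n).-1 := Ordinal (head_index_subproof j).
Definition tail_index j : 'I_(2 * n).-1 := Ordinal (tail_index_subproof j).

(* F(x_0, ..., x_{i-1}, F(x_i, ..., x_{i+n-1}), x_{i+n}, ..., x_{2n-2}) *)
Definition nested F x i : X :=
  F [tuple if j < i then tnth x (head_index j)
           else if j == i then F [tuple tnth x (block_index i l) | l < n]
           else tnth x (tail_index j) | j < n].

Definition nary_associative F : Prop :=
  forall x i j, j = i.+1 :> nat -> nested F x i = nested F x j.

Definition at_least_equal (k : nat) (t : n.-tuple X) : Prop :=
  exists2 A : {set 'I_n}, k <= #|A| &
    forall i j, i \in A -> j \in A -> tnth t i = tnth t j.

Definition class_F (k : nat) : set (n.-tuple X -> X) :=
  [set F | nary_associative F /\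
    forall t : n.-tuple X, at_least_equal k t -> exists i, F t = tnth t i].

End NaryOperations.

Arguments class_F : clear implicits.

(* Main.v *)
Require Import Defs.
From mathcomp Require Import all_boot.
From mathcomp Require Import zify.
From mathcomp Require Import boolp classical_sets functions cardinality.

Local Open Scope classical_set_scope.
Local Open Scope card_scope.

(** Write [u === v] when the words [u] and [v] are interchangeable inside every
    word of length [n] to which [F] is applied. Associativity and idempotency
    show that two letters [x], [y] satisfy [xy === xx], or [xy === yy], or else
    [F(x, ..., x, y) = y] and [F(x, y, ..., y) = x]. In the last case, if
    [x <> y], the two letters behave as the elements of a group of order two:
    [xy === yx] and [xx === yy]; moreover no third letter is in this relation to
    [y], because [F(x, ..., x, y, z)] is one of [x], [y], [z]. By induction,
    every word then reduces to [x ... x] or [x ... x y] with letters taken from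
    it, and the value of the latter on length [n] is [x] or [y]. *)

Section WordOperation.

Set Implicit Arguments.
Unset Strict Implicit.

(* The arity is [k.+3]. *)
Variables (X : eqType) (k : nat) (f : seq X -> X).

Hypothesis f_assoc : forall a b u x y,
  size a + size b = k.+1 -> size u = k.+2 ->
  f (a ++ [:: x; f (rcons u y)] ++ b) = f (a ++ [:: f (x :: u); y] ++ b).

Hypothesis f_choice : forall w x,
  size w = k.+3 -> k.+1 <= count_mem x w -> f w \in w.

(** * Interchangeability as a congruence on words *)

Definition word_equiv (u v : seq X) : Prop :=
  size u = size v /\
  forall a b, size a + size u + size b = k.+3 -> f (a ++ u ++ b) = f (a ++ v ++ b).

Local Notation "u === v" := (word_equiv u v) (at level 70).

Lemma word_equiv_sym u v : u === v -> v === u.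
Proof. by case=> suv uv; split=> // a b sab; rewrite uv // suv. Qed.

Lemma word_equiv_trans v u w : u === v -> v === w -> u === w.
Proof.
move=> [suv uv] [svw vw]; split=> [|a b sab]; first by rewrite suv.
by rewrite uv // vw // -suv.
Qed.

Lemma word_equiv_ctx a b u v : u === v -> a ++ u ++ b === a ++ v ++ b.
Proof.
move=> [suv uv]; split=> [|c d]; first by rewrite !size_cat suv.
rewrite !size_cat => scd.
by have := uv (c ++ a) (b ++ d); rewrite !size_cat -!catA; apply; lia.
Qed.

Lemma word_equiv_catl a u v : u === v -> a ++ u === a ++ v.
Proof. by move=> /(word_equiv_ctx a [::]); rewrite !cats0. Qed.

Lemma word_equiv_catr b u v : u === v -> u ++ b === v ++ b.
Proof. exact: (word_equiv_ctx [::] b). Qed.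

Lemma word_equiv_eval u v : size u = k.+3 -> u === v -> f u = f v.
Proof.
by move=> su [_ /(_ [::] [::])]; rewrite !cats0 /= addn0 add0n; apply.
Qed.

Lemma word_equiv_slide x u y : size u = k.+2 ->
  [:: x; f (rcons u y)] === [:: f (x :: u); y].
Proof. by move=> su; split=> // a b /= sab; apply: f_assoc => //; lia. Qed.

Lemma f_nseq x : f (nseq k.+3 x) = x.
Proof.
have /nseqP[-> //] : f (nseq k.+3 x) \in nseq k.+3 x.
by apply: (f_choice (x := x)); rewrite ?size_nseq // count_nseq /= eqxx; lia.
Qed.

(** * Possible relations between two letters *)

Definition absorbs_right x y := [:: x; y] === [:: x; x].
Definition absorbed_right x y := [:: x; y] === [:: y; y].
(** One-sided conditions, as these are what [absorb_or_units] leaves when it finds no absorption;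
    [units_sym] supplies the other sides. *)
Definition units x y := f (nseq k.+2 x ++ [:: y]) = y /\ f (x :: nseq k.+2 y) = x.

Lemma absorbs_right_rcons m x y : absorbs_right x y ->
  nseq m.+1 x ++ [:: y] === nseq m.+2 x.
Proof.
move=> xy; rewrite -(addn2 m) -(addn1 m) !nseqD -catA.
exact: (word_equiv_catl (nseq m x)).
Qed.

Lemma absorbed_right_cons m x y : absorbed_right x y ->
  x :: nseq m.+1 y === nseq m.+2 y.
Proof. exact: (word_equiv_catr (nseq m y)). Qed.

Lemma absorbed_right_rcons m x y : absorbed_right x y ->
  nseq m x ++ [:: y] === nseq m.+1 y.
Proof.
move=> xy; elim: m => [//|m IHm].
apply: word_equiv_trans (word_equiv_catl [:: x] IHm) _.
exact: absorbed_right_cons.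
Qed.

Lemma size_nseq_rcons m x (y : X) : size (nseq m x ++ [:: y]) = m.+1.
Proof. by rewrite size_cat size_nseq addn1. Qed.

Lemma f_absorbs_rcons x y : absorbs_right x y -> f (nseq k.+2 x ++ [:: y]) = x.
Proof.
move=> /(absorbs_right_rcons k.+1)/(word_equiv_eval (size_nseq_rcons _ _ _)) ->.
exact: f_nseq.
Qed.

Lemma f_absorbed_rcons x y : absorbed_right x y -> f (nseq k.+2 x ++ [:: y]) = y.
Proof.
move=> /(absorbed_right_rcons k.+2)/(word_equiv_eval (size_nseq_rcons _ _ _)) ->.
exact: f_nseq.
Qed.

Lemma f_absorbed_cons x y : absorbed_right x y -> f (x :: nseq k.+2 y) = y.
Proof.
move=> /(absorbed_right_cons k.+1)/word_equiv_eval ->; first exact: f_nseq.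
by rewrite /= size_nseq.
Qed.

Lemma absorbs_absorbed_eq x y : absorbs_right x y -> absorbed_right x y -> x = y.
Proof. by move=> /f_absorbs_rcons + /f_absorbed_rcons => ->. Qed.

Lemma rcons_nseq m (x : X) : rcons (nseq m x) x = x :: nseq m x.
Proof. by elim: m => //= m ->. Qed.

(** Let n = k+3 and bracket x^n y in two ways. The constant block has value x, so if x^(n-1) y also
    has value x, then xy === xx. Likewise x y^n gives xy === yy if x y^(n-1) has value y. Otherwise
    [f_choice] leaves exactly the two values in [units]. *)
Lemma absorb_or_units x y :
  [\/ absorbs_right x y, absorbed_right x y | units x y].
Proof.
have : f (nseq k.+2 x ++ [:: y]) \in nseq k.+2 x ++ [:: y].
  apply: (f_choice (x := x)); rewrite ?size_nseq_rcons //.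
  by rewrite count_cat count_nseq /= eqxx; lia.
rewrite mem_cat => /orP[/nseqP[xy _]|].
  constructor 1; apply: word_equiv_sym.
  have := @word_equiv_slide x (nseq k.+2 x) y.
  by rewrite -cats1 xy size_nseq -[x :: nseq _ _]/(nseq k.+3 x) f_nseq; apply.
rewrite inE => /eqP xy.
have : f (x :: nseq k.+2 y) \in x :: nseq k.+2 y.
  apply: (f_choice (x := y)); rewrite /= ?size_nseq //.
  by rewrite count_nseq /= eqxx; lia.
rewrite inE => /orP[/eqP|/nseqP[yx _]]; first by constructor 3.
constructor 2.
have := @word_equiv_slide x (nseq k.+2 y) y.
by rewrite rcons_nseq yx size_nseq -[y :: nseq _ _]/(nseq k.+3 y) f_nseq; apply.
Qed.

(** * Pairs of letters that are units for each other *)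

Lemma units_not_absorbs x y : x <> y -> units x y -> ~ absorbs_right x y.
Proof. by move=> nxy [xy _] /f_absorbs_rcons; rewrite xy => /esym. Qed.

Lemma units_not_absorbed x y : x <> y -> units x y -> ~ absorbed_right x y.
Proof. by move=> nxy [_ xy] /f_absorbed_cons; rewrite xy. Qed.

(** The two bracketings of x^(n-1) y z, whose first n letters have value y. *)
Lemma slide_left x y z :
  f (nseq k.+2 x ++ [:: y]) = y ->
  [:: x; f (nseq k.+1 x ++ [:: y; z])] === [:: y; z].
Proof.
move=> xy; have := @word_equiv_slide x (nseq k.+1 x ++ [:: y]) z.
by rewrite -cats1 -catA size_nseq_rcons -[in f (x :: _)]cat_cons xy; apply.
Qed.

Lemma slide_right x y z :
  f (y :: nseq k.+2 z) = y ->
  [:: x; y] === [:: f (x :: y :: nseq k.+1 z); z].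
Proof.
move=> yz; have := @word_equiv_slide x (y :: nseq k.+1 z) z.
by rewrite rcons_cons rcons_nseq [size _]/= size_nseq yz; apply.
Qed.

(** Here and in [f_letter3r] the threshold n-2 is used in full: n-2 copies of one letter leave room
    for two arbitrary ones. *)
Lemma f_letter3l x y z :
  [\/ f (nseq k.+1 x ++ [:: y; z]) = x, f (nseq k.+1 x ++ [:: y; z]) = y
    | f (nseq k.+1 x ++ [:: y; z]) = z].
Proof.
have : f (nseq k.+1 x ++ [:: y; z]) \in nseq k.+1 x ++ [:: y; z].
  apply: (f_choice (x := x)); rewrite ?size_cat ?size_nseq ?addn2 //.
  by rewrite count_cat count_nseq /= eqxx; lia.
rewrite mem_cat => /orP[/nseqP[-> _]|]; first by constructor.
by rewrite !inE => /orP[]/eqP->; constructor.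
Qed.

Lemma f_letter3r x y z :
  [\/ f [:: x, y & nseq k.+1 z] = x, f [:: x, y & nseq k.+1 z] = y
    | f [:: x, y & nseq k.+1 z] = z].
Proof.
have : f [:: x, y & nseq k.+1 z] \in [:: x, y & nseq k.+1 z].
  apply: (f_choice (x := z)); rewrite /= ?size_nseq //.
  by rewrite count_nseq /= eqxx; lia.
by rewrite 2!in_cons => /or3P[/eqP->|/eqP->|/nseqP[-> _]]; constructor.
Qed.

(** Suppose yx === yy. By [slide_left], yx === xc with c equal to x or y: c = x makes yx absorb both
    ways, so x = y, while c = y gives xy === yy, against [units x y]. The case yx === xx is the
    mirror image, by [slide_right]. *)
Lemma units_sym x y : x <> y -> units x y -> units y x.
Proof.
move=> nxy uxy; have [yx|yx|//] := absorb_or_units y x.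
- have := slide_left x uxy.1.
  have [] := f_letter3l x y x => -> e.
  + by case: nxy; apply/esym/absorbs_absorbed_eq => //; apply: word_equiv_sym.
  + by case: (units_not_absorbed nxy uxy); apply: word_equiv_trans e yx.
  + by case: nxy; apply/esym/absorbs_absorbed_eq => //; apply: word_equiv_sym.
- have := slide_right y uxy.2.
  have [] := f_letter3r y x y => -> e.
  + by case: nxy; apply/esym/absorbs_absorbed_eq.
  + case: (units_not_absorbs nxy uxy).
    exact: word_equiv_trans (word_equiv_sym e) yx.
  + by case: nxy; apply/esym/absorbs_absorbed_eq.
Qed.

Lemma units_comm x y : x <> y -> units x y -> [:: x; y] === [:: y; x].
Proof.
move=> nxy uxy; have uyx := units_sym nxy uxy.
have := slide_right x uyx.2.
by have [] := f_letter3r x y x => -> // /(units_not_absorbs nxy uxy).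
Qed.

Lemma units_square x y : x <> y -> units x y -> [:: x; x] === [:: y; y].
Proof.
move=> nxy uxy; have := slide_left y uxy.1.
by have [] := f_letter3l x y y => -> // /(units_not_absorbed nxy uxy).
Qed.

(** Since xx === yy === zz, either absorption for xz would bring the other and force x = z. *)
Lemma units_trans x y z : x <> y -> y <> z -> x <> z ->
  units x y -> units y z -> units x z.
Proof.
move=> nxy nyz nxz uxy uyz.
have xz := word_equiv_trans (units_square nxy uxy) (units_square nyz uyz).
have [e|e|//] := absorb_or_units x z; case: nxz; apply: absorbs_absorbed_eq => //.
- exact: word_equiv_trans e xz.
- exact: word_equiv_trans e (word_equiv_sym xz).
Qed.

Lemma eval_pair_cons x z y : f (z :: nseq k.+2 y) = z -> f (x :: nseq k.+2 y) = x ->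
  [:: x; y] === [:: z; y] -> x = z.
Proof.
move=> fz fx /(word_equiv_catr (nseq k.+1 y))/word_equiv_eval.
by rewrite size_cat size_nseq fz fx; apply.
Qed.

(** For a third letter z, [slide_left] gives yz === xc with c among x, y, z. If c = x, then yz ===
    yy. If c = y, then xy === zy, and appending y^(n-2) gives x = z. If c = z, then xz === yz, and
    appending z^(n-2) gives x = y. All are excluded. *)
Lemma units_third x y z : x <> y -> units x y -> units y z -> z = x \/ z = y.
Proof.
move=> nxy uxy uyz.
have [|/eqP nzx] := eqVneq z x; first by left.
have [|/eqP nzy] := eqVneq z y; first by right.
have nyz : y <> z by move/esym.
have uzy := units_sym nyz uyz.
have uxz := units_trans nxy nyz (nesym nzx) uxy uyz.
have := slide_left z uxy.1.
have [] := f_letter3l x y z => -> e.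
- case: (units_not_absorbs nyz uyz).
  exact: word_equiv_trans (word_equiv_sym e) (units_square nxy uxy).
- case: nzx; apply/esym/(eval_pair_cons uzy.2 uxy.2).
  exact: word_equiv_trans e (units_comm nyz uyz).
- by case: nxy; apply: (eval_pair_cons uyz.2 uxz.2).
Qed.

(** * Normal forms of words *)

Definition normal_form (w : seq X) : Prop :=
  (exists2 x, x \in w & w === nseq (size w) x) \/
  exists x y, [/\ x \in w, y \in w, x <> y, units x y
                & w === nseq (size w).-1 x ++ [:: y]].

(** Induction on the word: the new last letter z is compared with the last letter of the normal form
    of the prefix. *)
Lemma normal_form_exists w : 0 < size w -> normal_form w.
Proof.
elim/last_ind: w => [//|w z IHw _]; rewrite -cats1.
have zw : z \in w ++ [:: z] by rewrite mem_cat mem_head orbT.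
case: (posnP (size w)) => [/size0nil ->|w_gt0].
  by left; exists z; rewrite ?mem_head.
have sw x : x \in w -> x \in w ++ [:: z] by rewrite mem_cat => ->.
have szw : size (w ++ [:: z]) = (size w).+1 by rewrite size_cat addn1.
case: (IHw w_gt0) => [[x xw wx]|[x [y [xw yw nxy uxy wxy]]]];
  rewrite /normal_form szw -(prednK w_gt0) /=.
- have := word_equiv_catr [:: z] wx; rewrite -(prednK w_gt0) => wxz.
  have [e|e|uxz] := absorb_or_units x z.
  + left; exists x; first exact: sw.
    exact: word_equiv_trans wxz (absorbs_right_rcons _ e).
  + left; exists z; first by [].
    exact: word_equiv_trans wxz (absorbed_right_rcons _ e).
  + have [xz|/eqP nxz] := eqVneq x z.
      left; exists z => //; move: wxz; rewrite xz => wz.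
      apply: word_equiv_trans wz _.
      exact: absorbs_right_rcons.
    by right; exists x, z; split => //; apply: sw.
have := word_equiv_catr [:: z] wxy; rewrite -catA /=.
set m := (size w).-1 => {}wxy.
have square z' : x <> z' -> units x z' ->
    nseq m x ++ [:: z'; z'] === nseq m.+2 x.
  move=> nxz /(units_square nxz)/word_equiv_sym.
  by rewrite -addn2 nseqD; apply: word_equiv_catl.
have xxw : x \in w ++ [:: z] by exact: sw.
have [e|e|uyz] := absorb_or_units y z.
- left; exists x => //; apply: word_equiv_trans (square y nxy uxy).
  exact: word_equiv_trans wxy (word_equiv_catl _ e).
(* The word is now x^m zz, so x and z have to be compared in turn. *)
- have {}wxy := word_equiv_trans wxy (word_equiv_catl (nseq m x) e).
  have [d|d|uxz] := absorb_or_units x z.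
  (* If m = 0, no x is left and the constant word is made of z. *)
  + case: m wxy {square} => [|m] wxy; first by left; exists z.
    left; exists x => //; apply: word_equiv_trans wxy _.
    rewrite -[[:: z; z]]/([:: z] ++ [:: z]) catA.
    apply: word_equiv_trans (absorbs_right_rcons m.+1 d).
    exact/word_equiv_catr/absorbs_right_rcons.
  + left; exists z => //; apply: word_equiv_trans wxy _.
    have := word_equiv_catr [:: z] (absorbed_right_rcons m d).
    by rewrite -catA -(nseqD m.+1 1) addn1.
  + have [xz|/eqP nxz] := eqVneq x z.
      by left; exists x => //; move: wxy; rewrite -xz -(nseqD m 2) addn2.
    by left; exists x => //; apply: word_equiv_trans wxy (square z _ _).
(* Either z = x, which moves past y by [units_comm], or z = y, which completes a square yy to be
   replaced by xx. *)
- have [zx|zy] := units_third nxy uxy uyz.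
  + right; exists x, y; split=> //; first exact: sw.
    apply: word_equiv_trans wxy _; rewrite zx.
    rewrite -cat_cons -rcons_nseq cat_rcons.
    exact/word_equiv_catl/word_equiv_sym/units_comm.
  + left; exists x => //; apply: word_equiv_trans (square y nxy uxy).
    by rewrite -{2}zy.
Qed.

Lemma word_value_mem w : size w = k.+3 -> f w \in w.
Proof.
move=> sw; have [|[x xw]|[x [y [xw yw _ [xy _]]]]] := @normal_form_exists w.
- by rewrite sw.
- by rewrite sw => /(word_equiv_eval sw) ->; rewrite f_nseq.
- by rewrite sw => /(word_equiv_eval sw) ->; rewrite xy.
Qed.

End WordOperation.

(** * Operations on tuples read as operations on words *)

Section TupleOperation.

Set Implicit Arguments.
Unset Strict Implicit.

Variables (X : eqType) (n : nat) (t0 : n.-tuple X) (F : n.-tuple X -> X).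

(* The value on words of length other than [n] is the irrelevant [F t0]. *)
Definition word_operation (s : seq X) : X := F (insubd t0 s).

Lemma word_operationE (t : n.-tuple X) : word_operation t = F t.
Proof. by rewrite /word_operation valKd. Qed.

Lemma word_operation_tuple x0 (t : n.-tuple X) (s : seq X) :
  size s = n -> (forall j : 'I_n, tnth t j = nth x0 s j) ->
  F t = word_operation s.
Proof.
move=> ss ts; rewrite -word_operationE; congr word_operation.
apply: (@eq_from_nth _ x0) => [|j]; rewrite size_tuple // => jn.
by have := ts (Ordinal jn); rewrite (tnth_nth x0).
Qed.

Lemma nested_word (a u b : seq X) (w : (2 * n).-1.-tuple X) (i : 'I_n) :
  w = a ++ u ++ b :> seq X -> size a = i -> size u = n ->
  nested F w i = word_operation (a ++ word_operation u :: b).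
Proof.
move=> wE sa su; have i_n := ltn_ord i; set v := word_operation u.
have sb : size b = n.-1 - i.
  by have := size_tuple w; rewrite wE !size_cat; lia.
rewrite /nested; apply: (word_operation_tuple (x0 := v)).
  by rewrite size_cat /= sb; lia.
move=> j; have j_n := ltn_ord j.
rewrite tnth_mktuple !(tnth_nth v) wE -val_eqE /= !nth_cat sa su.
have [//|ij|/val_inj ->] := ltngtP j i; last first.
  rewrite subnn; apply: (word_operation_tuple (x0 := v)) => [|l]; first exact: su.
  rewrite tnth_mktuple (tnth_nth v) wE /= !nth_cat sa su.
  by rewrite ltnNge leq_addr addKn ltn_ord.
(* Here i < j: position j + n - 1 of [w] lies past [a] and [u], and both sides read [b] at j - i -
   1. *)
rewrite !ifF; try lia.
by rewrite -[j - i]prednK ?subn_gt0 //=; congr nth; lia.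
Qed.

Lemma word_operation_assoc : nary_associative F ->
  forall a b u x y, (size a + size b).+2 = n -> (size u).+1 = n ->
  word_operation (a ++ [:: x; word_operation (rcons u y)] ++ b) =
  word_operation (a ++ [:: word_operation (x :: u); y] ++ b).
Proof.
move=> Fa a b u x y sab su.
(* The two sides bracket this one word, at position |a| + 1 for the left side and |a| for the
   right. *)
have sw : size (a ++ (x :: u) ++ (y :: b)) == (2 * n).-1.
  by rewrite !size_cat /=; apply/eqP; lia.
have ai : size a < n by lia.
have aj : (size a).+1 < n by lia.
have := Fa (Tuple sw) (Ordinal ai) (Ordinal aj) erefl.
rewrite (nested_word (a := a) (u := x :: u) (b := y :: b)) //.
rewrite (nested_word (a := rcons a x) (u := rcons u y) (b := b)) //=.
- by rewrite cat_rcons => ->.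
- by rewrite cat_rcons cat_rcons.
- by rewrite size_rcons.
- by rewrite size_rcons.
Qed.

Lemma count_mem_at_least_equal x k (t : n.-tuple X) :
  k <= count_mem x t -> at_least_equal k t.
Proof.
rewrite -{1}[tval t]map_tnth_enum count_map enumT => kt.
exists [set i | tnth t i == x]%SET.
  apply: leq_trans kt _.
  by rewrite cardE /enum_mem size_filter; apply: sub_count => i /=; rewrite inE.
by move=> i j; rewrite !inE => /eqP-> /eqP->.
Qed.

End TupleOperation.

Lemma choice_of_almost_constant (X : eqType) (k : nat)
    (F : k.+3.-tuple X -> X) :
  nary_associative F ->
  (forall t, at_least_equal k.+1 t -> exists i, F t = tnth t i) ->
  forall t, exists i, F t = tnth t i.
Proof.
(* The tuple [t] itself serves as the default [t0]. *)
move=> Fa Fc t; apply/tnthP; rewrite -(word_operationE t F).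
apply: (@word_value_mem X k); rewrite ?size_tuple //.
  by move=> a b u x y sab su; apply: word_operation_assoc; rewrite ?sab ?su.
move=> w x /eqP sw xw; rewrite -[w]/(val (Tuple sw)) word_operationE.
by apply/tnthP/Fc/(count_mem_at_least_equal (x := x)).
Qed.

Theorem proposition1p1 (X : Type) (hX : `I_3 #<= [set: X]) (n : nat)
  (hn : (3 <= n)%N) : class_F X n 1 = class_F X n (n - 2).
Proof.
case: n hn => [|[|[|k]]] // _; rewrite subSS subSS subn0.
apply/seteqP; split=> F [Fa Fc]; split=> // t.
  by move=> [A kA At]; apply: Fc; exists A => //; apply: leq_trans kA.
(* [{classic X}] provides the Boolean equality used for membership and counting in words. *)
by move=> _; apply: (@choice_of_almost_constant {classic X} k F Fa Fc).
Qed.
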